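(* Let $n\in\mathbb{N}$ and let $\mathbf{x}=(x_1,\dots,x_n)$ and $\mathbf{y}=(y_1,\dots,y_n)$ be two distinct node systems with $0<x_1<\cdots<x_n<1$ and $0<y_1<\cdots<y_n<1$. Put $x_0:=y_0:=0$, $x_{n+1}:=y_{n+1}:=1$, and $I_j(\mathbf{x}):=[x_j,x_{j+1}]$, $I_j(\mathbf{y}):=[y_j,y_{j+1}]$ for $j=0,1,\dots,n$. Then there exist indices $0\le i\ne j\le n$ such that \[ \max_{t\in I_i(\mathbf{x})}\Bigl|\prod_{k=1}^n(t-x_k)\Bigr|<\max_{t\in I_i(\mathbf{y})}\Bigl|\prod_{k=1}^n(t-y_k)\Bigr| \quad\text{and}\quad \max_{t\in I_j(\mathbf{x})}\Bigl|\prod_{k=1}^n(t-x_k)\Bigr|>\max_{t\in I_j(\mathbf{y})}\Bigl|\prod_{k=1}^n(t-y_k)\Bigr|. \] *)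

(* Defs.v *)
From HB Require Import structures.
From mathcomp Require Import all_boot all_order all_algebra.
From mathcomp Require Import all_classical all_reals all_analysis.
Set Implicit Arguments.
Unset Strict Implicit.
Unset Printing Implicit Defensive.
Import Order.TTheory GRing.Theory Num.Theory.
Import numFieldNormedType.Exports.
Local Open Scope classical_set_scope.
Local Open Scope ring_scope.

(* The list x_0 = 0, x_1, ..., x_n, x_{n+1} = 1; the node x_k with 1 <= k <= n
   is the entry k - 1 of the tuple x. *)
Definition extended_nodes (R : realType) (n : nat) (x : n.-tuple R) : seq R :=
  0 :: rcons x 1.

(* 0 < x_1 < ... < x_n < 1 *)
Definition node_system (R : realType) (n : nat) (x : n.-tuple R) : bool :=
  sorted <%R (extended_nodes x).

Definition node_interval (R : realType) (n : nat) (x : n.-tuple R)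
    (j : 'I_n.+1) : set R :=
  `[(extended_nodes x)`_j, (extended_nodes x)`_j.+1].

Definition node_poly (R : realType) (n : nat) (x : n.-tuple R) (t : R) : R :=
  \prod_(k < n) (t - tnth x k).

(* The supremum is a maximum for node systems: see interval_maxP. *)
Definition interval_max (R : realType) (n : nat) (x : n.-tuple R)
    (j : 'I_n.+1) : R :=
  sup [set `|node_poly x t| | t in node_interval x j].

Lemma continuous_node_poly (R : realType) (n : nat) (x : n.-tuple R) :
  continuous (node_poly x).
Proof.
have -> : node_poly x = horner (\prod_(k < n) ('X - (tnth x k)%:P)).
  apply/funext => t; rewrite /node_poly horner_prod.
  by apply: eq_bigr => k _; rewrite hornerXsubC.
exact: continuous_horner.
Qed.

Lemma interval_maxP (R : realType) (n : nat) (x : n.-tuple R) (j : 'I_n.+1) :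
  node_system x ->
  (exists2 t, node_interval x j t & `|node_poly x t| = interval_max x j) /\
  (forall t, node_interval x j t -> `|node_poly x t| <= interval_max x j).
Proof.
move=> xs; set a := (extended_nodes x)`_j; set b := (extended_nodes x)`_j.+1.
have szx : size (extended_nodes x) = n.+2.
  by rewrite /= size_rcons size_tuple.
have leab : a <= b.
  have lejn : (j <= n)%N by rewrite -ltnS ltn_ord.
  by apply: ltW; apply: (sorted_ltn_nth lt_trans 0 xs); rewrite ?inE ?szx ?ltnS ?leqW.
have cf : {within `[a, b], continuous (fun t => `|node_poly x t|)}.
  apply: continuous_subspaceT => t.
  apply: (@continuous_comp _ _ _ (node_poly x) Num.norm).
    exact: continuous_node_poly.
  exact: norm_continuous.
have [c cab cmax] := EVT_max leab cf.
have ub : ubound [set `|node_poly x t| | t in node_interval x j]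
                 `|node_poly x c|.
  by move=> _ [t /= tab <-]; apply: cmax.
have supE : interval_max x j = `|node_poly x c|.
  apply/eqP; rewrite eq_le; apply/andP; split.
    by apply: ge_sup => //; exists `|node_poly x c|; exists c.
  by apply: ub_le_sup; [exists `|node_poly x c| | exists c].
split; first by exists c.
by move=> t tab; rewrite supE; apply: ub; exists t.
Qed.

(* Main.v *)
Require Import Defs.
From mathcomp Require Import all_boot all_order all_algebra.
From mathcomp Require Import all_classical all_reals all_analysis.
From mathcomp Require Import lra ring.
Import Order.TTheory GRing.Theory Num.Theory.
Local Open Scope ring_scope.

(** By symmetry between x and y it is enough to show that x = y as soon as every
    interval maximum of x is at most the corresponding one of y.

    Write P and Q for the node polynomials of x and y. The point is that
    (x, t) |-> log |P(t)| is jointly concave as long as t stays between the same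
    two consecutive nodes, because each log |t - x_k| is concave there. Hence so
    are the log-maxima as functions of x, and they lie below their tangents. Let
    s_j be a point of I_j(y) where |Q| is maximal and t_j a point of I_j(x) where
    |P| is maximal, or the endpoint 0 or 1 for the two outer intervals. The
    ratios u_jk = (s_j - y_k) / (t_j - x_k) are positive, and their product over
    k is |Q(s_j)| / |P(t_j)| >= 1. The tangent inequality is then the inequality
    of arithmetic and geometric means, and it reads
      0 <= sum_k (u_jk - 1) = V_j + D_j,
      V_j = (s_j - t_j) sum_k 1 / (t_j - x_k),
      D_j = sum_k (x_k - y_k) / (t_j - x_k).
    Here V_j <= 0 because t_j is stationary ([exists_stationary_point]), so
    D_j >= 0 for all j.

    These n + 1 conditions on the n numbers x_k - y_k are tied by one relation
    sum_j c_j D_j = 0 with c_j = P(t_j) / prod_(i != j) (t_j - t_i). It says that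
    the divided difference at n + 1 points of the polynomial P / (X - x_k), of
    degree n - 1, is zero ([interlaced_cauchy_kernel]). The t_j interlace with
    the x_k, so all the c_j are positive, and every D_j and V_j is zero. The
    equality case of the means inequality gives s_j - y_k = t_j - x_k for all j
    and k. Finally V_0 = 0 forces s_0 = t_0, since the terms 1 / (t_0 - x_k) are
    all negative, and y = x follows. *)

(** * Divided differences and the kernel of an interlaced Cauchy matrix *)

(** The sum is the coefficient of degree n of the Lagrange interpolation
    polynomial of p at the n + 1 points t, and that polynomial is p. *)
Lemma leading_divided_difference_eq0 (F : fieldType) (n : nat)
    (t : 'I_n.+1 -> F) (p : {poly F}) :
    injective t -> (size p <= n)%N ->
  \sum_j p.[t j] / \prod_(k < n) (t j - t (lift j k)) = 0.
Proof.
move=> tI szp.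
pose w j := \prod_(k < n) (t j - t (lift j k)).
have w0 j : w j != 0.
  apply/prodf_neq0 => k _; rewrite subr_eq0; apply/eqP => /tI jk.
  by have := @neq_lift n.+1 j k; rewrite -jk eqxx.
pose l (j : 'I_n.+1) := \prod_(k < n) ('X - (t (lift j k))%:P).
have szl j : size (l j) = n.+1.
  by rewrite size_prod_XsubC -[index_enum _]enumT size_enum_ord.
pose q := \sum_j (p.[t j] / w j) *: l j.
have pq : p - q = 0.
  apply: (@roots_geq_poly_eq0 _ _ [seq t j | j <- enum 'I_n.+1]).
  - apply/allP => _ /mapP[i _ ->]; rewrite rootE hornerD hornerN subr_eq0.
    rewrite horner_sum (bigD1 i) //= big1 ?addr0 => [|j ji].
      rewrite hornerZ horner_prod.
      under eq_bigr do rewrite hornerXsubC.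
      by rewrite -/(w i) divfK.
    have [k ik] := unlift_some ji.
    move=> _; rewrite hornerZ horner_prod (bigD1 k) //= hornerXsubC.
    by rewrite -ik subrr mul0r mulr0.
  - by rewrite map_inj_uniq // enum_uniq.
  rewrite size_map size_enum_ord (leq_trans (size_polyD _ _)) // geq_max.
  rewrite (leq_trans szp) // size_polyN.
  apply: (leq_trans (size_sum _ _ _)); apply/bigmax_leqP => j _.
  by rewrite (leq_trans (size_scale_leq _ _)) // szl.
have : q`_n = 0 by rewrite -(subr0_eq pq) nth_default.
rewrite coef_sum => q0; rewrite -[RHS]q0; apply: eq_bigr => j _.
rewrite coefZ; suff -> : (l j)`_n = 1 by rewrite mulr1.
by have := lead_coef_prod_XsubC (index_enum 'I_n) xpredT (fun k => t (lift j k));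
  rewrite lead_coefE szl.
Qed.

(** A left null vector of the matrix 1 / (t_j - x_k), which has one row more than
    columns. Its entries are written as products of ratios so that, when t and x
    interlace, each factor is visibly positive. *)
Lemma interlaced_cauchy_kernel (F : fieldType) (n : nat)
    (t : 'I_n.+1 -> F) (x : 'I_n -> F) (k : 'I_n) :
    injective t -> (forall j i, t j - x i != 0) ->
  \sum_j (\prod_(i < n) ((t j - x i) / (t j - t (lift j i)))) / (t j - x k) = 0.
Proof.
move=> tI tx.
pose p := \prod_(i < n | i != k) ('X - (x i)%:P).
have szp : (size p <= n)%N.
  have : size (('X - (x k)%:P) * p) = n.+1.
    have := size_prod_XsubC (index_enum 'I_n) x.
    by rewrite (bigD1 k) //= => ->; rewrite -[index_enum _]enumT size_enum_ord.
  rewrite size_Mmonic ?monic_prod_XsubC ?polyXsubC_eq0 //.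
  by rewrite size_XsubC add2n => -[->].
rewrite -[RHS](leading_divided_difference_eq0 _ _ t p tI szp).
apply: eq_bigr => j _; rewrite prodf_div mulrAC; congr (_ / _).
rewrite (bigD1 k) //= mulrC mulKf // horner_prod.
by apply: eq_bigr => i _; rewrite hornerXsubC.
Qed.

(** * The tangent inequality *)

(** A form, free of logarithms, of log v <= v - 1 summed over the entries of u
    with its equality case. It follows from the comparison of the arithmetic and
    the geometric mean, the latter being at least 1. *)
Lemma sum_sub1_ge0_leif (R : realFieldType) (I : finType) (u : I -> R) :
    (forall i, 0 < u i) -> 1 <= \prod_i u i ->
  0 <= \sum_i (u i - 1) ?= iff [forall i, u i == 1].
Proof.
move=> u0 u1; case: (posnP #|I|) => [I0|I0].
  have nI (i : I) : False by have := max_card (pred1 i); rewrite I0 card1.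
  rewrite big1 => [|i]; last by case: (nI i).
  by split=> //; rewrite eqxx; apply/esym/forallP => i; case: (nI i).
have c0 : 0 < #|I|%:R :> R by rewrite ltr0n.
have [/= le_mu eq_mu] := @leif_AGM R I predT u (fun i _ => ltW (u0 i)).
rewrite -[#|_|]/#|I| in le_mu eq_mu.
set S := \sum_(i in _) u i in le_mu eq_mu.
have SE : \sum_i (u i - 1) = S - #|I|%:R.
  by rewrite big_split /= sumrN sumr_const.
have S0 : 0 <= S by apply: sumr_ge0 => i _; exact: ltW.
have cS : #|I|%:R <= S.
  rewrite -[_%:R]mul1r -ler_pdivlMr //.
  have := le_trans u1 le_mu; rewrite -[X in X <= _](expr1n _ #|I|).
  by rewrite ler_pXn2r ?nnegrE ?divr_ge0 // ltW.
split; rewrite SE ?subr_ge0 //.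
apply/eqP/forallP => [S1 i|u_1]; last first.
  rewrite /S (eq_bigr (fun=> 1)) => [|i _]; last exact/eqP.
  by rewrite sumr_const subrr.
have {}S1 : S = #|I|%:R by apply/eqP; rewrite -subr_eq0 -S1.
have : \prod_i u i == 1.
  by rewrite eq_le u1 andbT (le_trans le_mu) // S1 divff ?lt0r_neq0 // expr1n.
move: eq_mu; rewrite S1 divff ?lt0r_neq0 // expr1n => -> /forall_inP uu.
have uE j : u j = u i by apply/esym/eqP; exact: (forall_inP (uu i _)).
move: S1; rewrite /S (eq_bigr (fun=> u i)) // sumr_const -[u i *+ _]mulr_natr.
by move/eqP; rewrite -{2}[_%:R]mul1r (inj_eq (mulIf _)) ?lt0r_neq0.
Qed.

(** * Stationary points of node polynomials *)

Lemma horner_deriv_prod_XsubC (F : fieldType) (I : Type) (r : seq I)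
    (x : I -> F) (t : F) :
    (forall i, t - x i != 0) ->
  (\prod_(i <- r) ('X - (x i)%:P))^`().[t] =
  (\prod_(i <- r) (t - x i)) * \sum_(i <- r) (t - x i)^-1.
Proof.
move=> tx; elim: r => [|i r IH]; first by rewrite !big_nil derivC hornerC mulr0.
rewrite !big_cons derivM hornerD !hornerM IH derivXsubC hornerC hornerXsubC.
rewrite horner_prod; under eq_bigr do rewrite hornerXsubC.
by field; apply: tx.
Qed.

Lemma size_extended_nodes (R : realType) (n : nat) (x : n.-tuple R) :
  size (extended_nodes x) = n.+2.
Proof. by rewrite /= size_rcons size_tuple. Qed.

Lemma nth_extended_nodesS (R : realType) (n : nat) (x : n.-tuple R) (k : 'I_n) :
  (extended_nodes x)`_k.+1 = tnth x k.
Proof. by rewrite /= nth_rcons size_tuple ltn_ord (tnth_nth 0). Qed.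

Lemma nth_extended_nodes_last (R : realType) (n : nat) (x : n.-tuple R) :
  (extended_nodes x)`_n.+1 = 1.
Proof. by rewrite /= nth_rcons size_tuple ltnn eqxx. Qed.

Lemma node_intervalE (R : realType) (n : nat) (x : n.-tuple R) (j : 'I_n.+1)
    (t : R) :
  node_interval x j t =
  ((extended_nodes x)`_j <= t <= (extended_nodes x)`_j.+1) :> Prop.
Proof. by rewrite /node_interval set_itvcc. Qed.

Lemma extended_nodes_lt (R : realType) (n : nat) (x : n.-tuple R) (a b : nat) :
    node_system x -> (a < b < n.+2)%N ->
  (extended_nodes x)`_a < (extended_nodes x)`_b.
Proof.
move=> hx /andP[ab bn].
by rewrite lt_sorted_ltn_nth // inE size_extended_nodes // (ltn_trans ab).
Qed.

Lemma extended_nodes_le (R : realType) (n : nat) (x : n.-tuple R) (a b : nat) :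
    node_system x -> (a <= b < n.+2)%N ->
  (extended_nodes x)`_a <= (extended_nodes x)`_b.
Proof.
move=> hx /andP[]; rewrite leq_eqVlt => /orP[/eqP -> //|ab bn].
by rewrite ltW ?extended_nodes_lt ?ab.
Qed.

Lemma node_in01 (R : realType) (n : nat) (x : n.-tuple R) (k : 'I_n) :
  node_system x -> 0 < tnth x k < 1.
Proof.
move=> hx; rewrite -nth_extended_nodesS -(nth_extended_nodes_last _ _ x).
rewrite -[X in X < _ < _]/((extended_nodes x)`_0).
by rewrite !extended_nodes_lt //= !ltnS ?leqnn ?ltn_ord // ltnW.
Qed.

Lemma node_interval_sub01 (R : realType) (n : nat) (x : n.-tuple R)
    (j : 'I_n.+1) (t : R) :
  node_system x -> node_interval x j t -> 0 <= t <= 1.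
Proof.
move=> hx; rewrite node_intervalE => /andP[jt tj].
have jn : (j <= n)%N by rewrite -ltnS.
rewrite (le_trans _ jt); last exact: (extended_nodes_le _ _ x 0 j hx (leqW jn)).
rewrite (le_trans tj) // -(nth_extended_nodes_last _ _ x).
by rewrite extended_nodes_le // !ltnS jn /=.
Qed.

Lemma node_interval_side (R : realType) (n : nat) (x : n.-tuple R)
    (j : 'I_n.+1) (t : R) (k : 'I_n) :
    node_system x -> node_interval x j t ->
  if (k < j)%N then tnth x k <= t else t <= tnth x k.
Proof.
move=> hx; rewrite node_intervalE -nth_extended_nodesS => /andP[et te].
have kn := ltn_ord k; have jn := ltn_ord j.
case: ltnP => kj.
  by apply: (le_trans _ et); rewrite extended_nodes_le // kj ltnW.
by apply: (le_trans te); rewrite extended_nodes_le // !ltnS kj ltnW.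
Qed.

(** Working with the square of the polynomial makes the maximum of its absolute
    value smooth, so that Fermat's rule applies to it. *)
Lemma sum_inv_eq0_at_max (R : realType) (n : nat) (x : n.-tuple R) (a b t : R) :
    t \in `]a, b[ -> node_poly x t != 0 ->
    (forall u, u \in `]a, b[ -> `|node_poly x u| <= `|node_poly x t|) ->
  \sum_k (t - tnth x k)^-1 = 0.
Proof.
move=> tab Pt0 tmax.
have tx k : t - tnth x k != 0 by move/prodf_neq0: Pt0 => /(_ k isT).
pose p := \prod_(k < n) ('X - (tnth x k)%:P).
have pE u : p.[u] = node_poly x u.
  by rewrite horner_prod; apply: eq_bigr => k _; rewrite hornerXsubC.
have dp2 : is_derive t 1 (horner (p ^+ 2)) 0.
  apply: (@derive1_at_max R _ a b) => //.
    move: tab; rewrite in_itv /= => /andP[at_ tb].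
    exact: ltW (lt_trans at_ tb).
  move=> u uab; rewrite !horner_exp !pE.
  rewrite -(real_normK (num_real (node_poly x u))).
  rewrite -(real_normK (num_real (node_poly x t))).
  by rewrite ler_sqr ?nnegrE // tmax.
have dp : p^`().[t] = 0.
  have : (p ^+ 2)^`().[t] = 0.
    by rewrite derivE derive1E (@derive_val _ _ _ _ _ _ _ dp2).
  rewrite deriv_exp /= expr1 hornerMn hornerM => /eqP.
  by rewrite mulrn_eq0 /= mulf_eq0 pE (negPf Pt0) orbF => /eqP.
move: dp; rewrite horner_deriv_prod_XsubC // => /eqP.
by rewrite mulf_eq0 -/(node_poly x t) (negPf Pt0) /= => /eqP.
Qed.

Lemma interval_max_gt0 (R : realType) (n : nat) (x : n.-tuple R) (j : 'I_n.+1) :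
  node_system x -> 0 < interval_max x j.
Proof.
move=> hx; have [_ jmax] := interval_maxP j hx.
set a := (extended_nodes x)`_j; set b := (extended_nodes x)`_j.+1.
have ab : a < b by rewrite extended_nodes_lt // ltnSn !ltnS -ltnS ltn_ord.
have ac : a < (a + b) / 2 by lra.
have cb : (a + b) / 2 < b by lra.
have cj : node_interval x j ((a + b) / 2) by rewrite node_intervalE !ltW.
rewrite (lt_le_trans _ (jmax _ cj)) // normr_gt0.
apply/prodf_neq0 => k _; rewrite subr_eq0.
(* The midpoint lies strictly on the side of each node on which a and b lie. *)
have aj : node_interval x j a by rewrite node_intervalE lexx ltW.
have bj : node_interval x j b by rewrite node_intervalE lexx ltW.
have := node_interval_side _ _ _ _ _ k hx bj.
have := node_interval_side _ _ _ _ _ k hx aj.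
case: ifP => _ ka kb; first by rewrite gt_eqF // (le_lt_trans ka).
by rewrite lt_eqF // (lt_le_trans cb).
Qed.

(** The sum is the logarithmic derivative of the node polynomial at t applied to
    the displacement s - t. It vanishes at an interior maximum. On the two outer
    intervals the endpoints 0 and 1 serve as t: each |t - x_k| decreases when t
    moves from there into [0, 1], so all the terms are nonpositive. *)
Lemma exists_stationary_point (R : realType) (n : nat) (x : n.-tuple R)
    (j : 'I_n.+1) :
    node_system x ->
  exists t, [/\ node_interval x j t, node_poly x t != 0,
    `|node_poly x t| <= interval_max x j &
    forall s, 0 <= s <= 1 -> \sum_k (s - t) / (t - tnth x k) <= 0].
Proof.
move=> hx; have [[t tj tmax] jmax] := interval_maxP j hx.
have jn : (j <= n)%N by rewrite -ltnS.
have ejj : (extended_nodes x)`_j < (extended_nodes x)`_j.+1.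
  by rewrite extended_nodes_lt // ltnSn !ltnS.
have [j0|j_gt0] := posnP j.
  have I0 : node_interval x j 0.
    rewrite node_intervalE j0 lexx ltW //.
    by rewrite -[X in X < _]/((extended_nodes x)`_0) -j0.
  exists 0; split=> //.
  - apply/prodf_neq0 => k _; rewrite sub0r oppr_eq0 lt0r_neq0 //.
    by case/andP: (node_in01 _ _ _ k hx).
  - exact: jmax.
  - move=> s /andP[s0 _]; apply: sumr_le0 => k _.
    rewrite subr0 sub0r invrN mulrN oppr_le0 divr_ge0 // ltW //.
    by case/andP: (node_in01 _ _ _ k hx).
have [jEn|j_neqn] := eqVneq (j : nat) n.
  have I1 : node_interval x j 1.
    have ej1 : (extended_nodes x)`_j.+1 = 1.
      by rewrite jEn nth_extended_nodes_last.
    by rewrite node_intervalE ej1 lexx andbT -ej1 ltW.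
  exists 1; split=> //.
  - apply/prodf_neq0 => k _; rewrite subr_eq0 gt_eqF //.
    by case/andP: (node_in01 _ _ _ k hx).
  - exact: jmax.
  - move=> s /andP[_ s1]; apply: sumr_le0 => k _.
    rewrite mulr_le0_ge0 ?subr_le0 // invr_ge0 subr_ge0 ltW //.
    by case/andP: (node_in01 _ _ _ k hx).
have j_ltn : (j < n)%N by rewrite ltn_neqAle j_neqn.
set a := (extended_nodes x)`_j in ejj; set b := (extended_nodes x)`_j.+1 in ejj.
have Pt0 : node_poly x t != 0 by rewrite -normr_gt0 tmax interval_max_gt0.
have tx k : t - tnth x k != 0 by move/prodf_neq0: Pt0 => /(_ k isT).
(* Both ends of an inner interval are nodes, hence zeros of the polynomial. *)
have tab : t \in `]a, b[.
  have aE : a = tnth x (Ordinal (leq_ltn_trans (leq_pred j) j_ltn)).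
    rewrite -nth_extended_nodesS /= -[in RHS](prednK j_gt0).
    by rewrite /a -{1}(prednK j_gt0).
  have bE : b = tnth x (Ordinal j_ltn) by rewrite -nth_extended_nodesS.
  have : a <= t <= b by rewrite -node_intervalE.
  rewrite in_itv /= !le_eqVlt => /andP[/orP[/eqP at_|->] /orP[/eqP tb|->]] //.
  - by move: ejj; rewrite at_ tb ltxx.
  - have := tx (Ordinal (leq_ltn_trans (leq_pred j) j_ltn)).
    by rewrite -aE at_ subrr eqxx.
  - by have := tx (Ordinal j_ltn); rewrite -bE tb subrr eqxx.
exists t; split=> //; first by rewrite tmax.
move=> s _; rewrite -mulr_sumr (sum_inv_eq0_at_max _ _ _ a b) ?mulr0 //.
move=> u; rewrite in_itv /= => /andP[au ub].
by rewrite tmax jmax // node_intervalE !ltW.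
Qed.

(** * Comparison of two node systems *)

Lemma same_side_ratio_gt0 (R : realFieldType) (b : bool) (u v : R) :
    u != 0 -> v != 0 ->
    (if b then 0 <= u else u <= 0) -> (if b then 0 <= v else v <= 0) ->
  0 < u / v.
Proof.
case: b => u0 v0 hu hv; first by rewrite divr_gt0 // lt0r ?u0 ?v0.
by rewrite -mulrNN -invrN divr_gt0 // lt0r oppr_eq0 ?u0 ?v0 oppr_ge0.
Qed.

Lemma eq_of_interval_max_le (R : realType) (n : nat) (x y : n.-tuple R) :
    node_system x -> node_system y ->
    (forall j, interval_max x j <= interval_max y j) -> x = y.
Proof.
move=> hx hy Mxy.
have [t tP] := choice (fun j => exists_stationary_point _ _ x j hx).
have /choice[s sP] j : exists s, node_interval y j s /\
    `|node_poly y s| = interval_max y j.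
  by have [[s ys sE] _] := interval_maxP j hy; exists s.
have tx j k : t j - tnth x k != 0.
  by case: (tP j) => _ /prodf_neq0/(_ k isT).
have sy j k : s j - tnth y k != 0.
  have : node_poly y (s j) != 0.
    case: (tP j) => _ t0 tM _; rewrite -normr_gt0 (sP j).2.
    by rewrite (lt_le_trans _ (le_trans tM (Mxy j))) // normr_gt0.
  by move/prodf_neq0/(_ k isT).
pose u j k := (s j - tnth y k) / (t j - tnth x k).
have u_gt0 j k : 0 < u j k.
  have [tj _ _ _] := tP j; have [sj _] := sP j.
  apply: (@same_side_ratio_gt0 _ (k < j)%N) => //.
    by have := node_interval_side _ _ _ _ _ k hy sj; case: ifP;
      rewrite ?subr_ge0 ?subr_le0.
  by have := node_interval_side _ _ _ _ _ k hx tj; case: ifP;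
    rewrite ?subr_ge0 ?subr_le0.
have u_ge1 j : 1 <= \prod_k u j k.
  have [_ t0 tM _] := tP j.
  rewrite -[leRHS]ger0_norm; last by apply: prodr_ge0 => k _; exact: ltW.
  rewrite prodf_div normf_div -/(node_poly y (s j)) -/(node_poly x (t j)).
  rewrite ler_pdivlMr ?normr_gt0 // mul1r (sP j).2.
  exact: le_trans (Mxy j).
have lt_t (i j : 'I_n.+1) : (i < j)%N -> t i < t j.
  move=> ij; have ni : (i < n)%N by rewrite (leq_trans ij) // -ltnS.
  have [ti _ _ _] := tP i; have [tj _ _ _] := tP j.
  (* The node of index i lies between t_i and t_j and differs from both. *)
  have := node_interval_side _ _ _ _ _ (Ordinal ni) hx ti.
  rewrite /= ltnn => tix.
  have := node_interval_side _ _ _ _ _ (Ordinal ni) hx tj; rewrite /= ij.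
  by apply: lt_le_trans; rewrite lt_neqAle tix andbT -subr_eq0.
have t_inj : injective t.
  move=> i j tij; apply: val_inj => /=.
  by case: (ltngtP i j) => // /lt_t; rewrite tij ltxx.
(* Numerator and denominator of each ratio are both positive exactly for k < j:
   the nodes and the other points on the left of t_j are those of index k < j,
   and lift j k runs over the indices other than j in increasing order. *)
pose c j := \prod_k ((t j - tnth x k) / (t j - t (lift j k))).
have c_gt0 j : 0 < c j.
  apply: prodr_gt0 => k _; have [tj _ _ _] := tP j.
  apply: (@same_side_ratio_gt0 _ (k < j)%N) => //.
  - by rewrite subr_eq0; apply/eqP => /t_inj/eqP; rewrite (negPf (neq_lift j k)).
  - by have := node_interval_side _ _ _ _ _ k hx tj; case: ifP;
      rewrite ?subr_ge0 ?subr_le0.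
  - case: ltnP => kj; rewrite ?subr_ge0 ?subr_le0 ltW // lt_t //= /bump.
      by rewrite [(j <= k)%N]leqNgt kj.
    by rewrite kj.
pose D j := \sum_k (tnth x k - tnth y k) / (t j - tnth x k).
have cD : \sum_j c j * D j = 0.
  under eq_bigr do rewrite mulr_sumr.
  rewrite exchange_big big1 //= => k _.
  under eq_bigr do rewrite mulrCA.
  by rewrite -mulr_sumr interlaced_cauchy_kernel ?mulr0.
pose V j := \sum_k (s j - t j) / (t j - tnth x k).
have V_le0 j : V j <= 0.
  by have [_ _ _] := tP j; apply; exact: node_interval_sub01 hy (sP j).1.
have uVD j : \sum_k (u j k - 1) = V j + D j.
  rewrite -big_split; apply: eq_bigr => k _ /=.
  by rewrite /u; field; apply: tx.
have D_ge0 j : 0 <= D j.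
  have := (sum_sub1_ge0_leif _ _ _ (u_gt0 j) (u_ge1 j)).1; rewrite uVD.
  by move: (V_le0 j); lra.
have D0 j : D j = 0.
  have cD0 i : true -> 0 <= c i * D i by move=> _; rewrite mulr_ge0 // ltW.
  have /eqP := psumr_eq0P cD0 cD (erefl : xpredT j).
  by rewrite mulf_eq0 gt_eqF //= => /eqP.
have V0 j : V j = 0.
  have := (sum_sub1_ge0_leif _ _ _ (u_gt0 j) (u_ge1 j)).1; rewrite uVD D0.
  by move: (V_le0 j); lra.
have st j k : s j - tnth y k = t j - tnth x k.
  have [_] := sum_sub1_ge0_leif _ _ _ (u_gt0 j) (u_ge1 j).
  rewrite uVD V0 D0 addr0 eqxx => /esym/forallP/(_ k)/eqP.
  by move/divr1_eq.
apply: eq_from_tnth => k; suff s0 : s ord0 = t ord0.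
  by move: (st ord0 k); rewrite s0 => /addrI/oppr_inj.
(* V_0 is (s_0 - t_0) times a sum of negative terms. *)
have inv_le0 i : (t ord0 - tnth x i)^-1 <= 0.
  have [t0 _ _ _] := tP ord0; rewrite invr_le0 subr_le0.
  exact: (node_interval_side _ _ _ _ _ i hx t0).
have /eqP := V0 ord0; rewrite /V -mulr_sumr mulf_eq0 subr_eq0 => /orP[/eqP//|].
rewrite (bigD1 k) //= lt_eqF // ltr_wnDr ?sumr_le0 // lt_neqAle inv_le0 andbT.
by rewrite invr_eq0.
Qed.

Theorem corollary4p1 (R : realType) (n : nat) (x y : n.-tuple R)
    (hx : node_system x) (hy : node_system y) (hxy : x <> y) :
  exists i j : 'I_n.+1,
    [/\ i <> j,
        interval_max x i < interval_max y i
      & interval_max x j > interval_max y j].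
Proof.
have ex (a b : n.-tuple R) : node_system a -> node_system b -> a <> b ->
    exists i, interval_max a i < interval_max b i.
  move=> ha hb ab; apply: contrapT => nlt; apply: ab; apply/esym.
  apply: eq_of_interval_max_le => // j; rewrite leNgt; apply/negP => lt_j.
  by apply: nlt; exists j.
have [i lti] := ex x y hx hy hxy.
have [j ltj] := ex y x hy hx (fun e => hxy (esym e)).
exists i, j; split=> // ij; move: ltj; rewrite -ij => /(lt_trans lti).
by rewrite ltxx.
Qed.
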